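(* In case of trapezoidal configuration of size $(n,m)$, the vertices of the polytope $\mathcal{SC}(\lambda\setminus\bar\lambda)$ are in one-to-one correspondence with the forests $H'$ in $H_{n,m}$ having $L(\bar\lambda)$ as the set of roots and $L(\lambda)$ as the set of leaves and satisfying the following condition: for each component $Q$ of $H'$ the value $$\sum_{(n,j)\in V(Q)}(\lambda_j-\lambda_{j+1})-\sum_{(0,j)\in V(Q)}(\bar\lambda_j-\bar\lambda_{j+1})\qquad( * )$$ is zero, and for each edge $e=(u,v)$ of $H'$ and the component $Q$ of $H'\setminus\{e\}$ containing $v$, the value $( * )$ is positive. Therefore, in case $m=0$, the vertices of $\mathcal{SC}(\lambda)$ (the polytope $\mathcal{SC}(\lambda\setminus\bar\lambda)$ with $\bar\lambda$ empty) are in one-to-one correspondence with the rooted trees in $H_n:=H_{n,0}$ with root $(0,0)$ and set of leaves $L(\lambda)$.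
   Context: Setting. Let $n\ge 1$, $m\ge 0$ be integers, and let $\lambda=(\lambda_1,\ldots,\lambda_{n+m})$ and $\bar\lambda=(\bar\lambda_1,\ldots,\bar\lambda_m)$ be real, weakly decreasing tuples. It is assumed throughout that $\lambda$ is nonnegative; this is a normalization, since adding one constant to all entries of $\lambda$ and $\bar\lambda$ just adds this constant to the row derivatives of the arrays below. Trapezoidal arrays. Let $V=\{(i,j)\in\mathbb Z^2: 0\le i\le n,\ 0\le j\le i+m\}$. A trapezoidal array of size $(n,m)$ is $X=(x_{ij})\in\mathbb R^V$; its row derivative is $\partial x_{ij}:=x_{ij}-x_{i,j-1}$ for $0\le i\le n$, $1\le j\le i+m$. $X$ is strip-concave if for all $i=1,\ldots,n$: $\partial x_{ij}\ge \partial x_{i-1,j}$ for $1\le j\le i-1+m$, and $\partial x_{i-1,j}\ge\partial x_{i,j+1}$ for $1\le j\le i+m-1$. $\mathcal{SC}(\lambda\setminus\bar\lambda)$ denotes the polytope of all strip-concave $X\in\mathbb R^V$ with $x_{i0}=0$ for $i=0,\ldots,n$, $\partial x_{nj}=\lambda_j$ for $j=1,\ldots,n+m$, and $\partial x_{0j}=\bar\lambda_j$ for $j=1,\ldots,m$ (the right boundary is not prescribed). Conventions: $\lambda_0:=\bar\lambda_0:=\lambda_1$ and $\lambda_{n+m+1}:=\bar\lambda_{m+1}:=0$. The digraph $H_{n,m}$ has node set $V$ and the directed edges $e^0_{ij}=((i,j),(i+1,j))$ and $e^1_{ij}=((i,j),(i+1,j+1))$ for $0\le i\le n-1$, $0\le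 j\le i+m$. $L(\lambda)$ is the set of nodes $(n,j)$, $1\le j\le n+m$, with $\lambda_j>\lambda_{j+1}$; $L(\bar\lambda)$ is the set of nodes $(0,j)$, $0\le j\le m$, with $\bar\lambda_j>\bar\lambda_{j+1}$. A forest in $H_{n,m}$ is a subgraph whose underlying undirected graph is acyclic; its roots are its nodes of zero indegree, its leaves are its nodes of zero outdegree (in the subgraph); components are those of the underlying undirected graph. A rooted tree with root $(0,0)$ is a connected forest whose only node of zero indegree is $(0,0)$. $V(Q)$ is the node set of $Q$; $H'\setminus\{e\}$ is obtained by deleting the edge $e$ only (keeping its end nodes). The correspondence is the following. For $X\in\mathcal{SC}(\lambda\setminus\bar\lambda)$ let $g=\gamma(X)$ be the (nonnegative) flow on the edges of $H_{n,m}$ given by $g(e^0_{ij})=\partial x_{ij}-\partial x_{i+1,j+1}$ and $g(e^1_{ij})=\partial x_{i+1,j+1}-\partial x_{i,j+1}$, where $\partial x_{i0}:=\lambda_1$ and $\partial x_{i,i+m+1}:=0$. A vertex $X$ corresponds to the subgraph $H(g)$ of $H_{n,m}$ induced by the edges $e$ with $g(e)>0$.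
   Formalization: In the case m=0 it is additionally assumed that λ_1>0, i.e. λ≠0; for λ=0 the polytope SC(λ) is a single point, hence has one vertex, while no rooted tree with root (0,0) has the empty set L(λ) as its set of leaves. *)

(* Defs.v *)
From mathcomp Require Import all_boot all_order all_algebra.
From mathcomp Require Import all_classical reals.

Set Implicit Arguments.
Unset Strict Implicit.
Unset Printing Implicit Defensive.

Import Order.TTheory GRing.Theory Num.Theory.
Local Open Scope ring_scope.

(* The index set V = {(i, j) : 0 <= i <= n, 0 <= j <= i + m}. *)
Notation node n m :=
  {p : 'I_n.+1 * 'I_(n + m).+1 | (p.2 <= p.1 + m)%N}.

Definition row_of (n m : nat) (v : node n m) : nat := (val v).1.
Definition col_of (n m : nat) (v : node n m) : nat := (val v).2.

Definition origin (n m : nat) : node n m := exist _ (ord0, ord0) isT.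

(* [R^o] provides the vector space structure of R^V. *)
Notation array R n m := {ffun node n m -> R^o}.

(* x_{ij} for (i, j) in V; the value 0 outside V is never used below. *)
Definition entry (R : realType) (n m : nat) (X : array R n m) (i j : nat) : R :=
  if [pick v : node n m | (row_of v == i) && (col_of v == j)] is Some v
  then X v else 0.

Definition row_deriv (R : realType) (n m : nat) (X : array R n m)
    (i j : nat) : R :=
  entry X i j - entry X i j.-1.

Definition strip_concave (R : realType) (n m : nat) (X : array R n m) : Prop :=
  forall i : nat, (1 <= i <= n)%N ->
    (forall j : nat, (1 <= j <= i.-1 + m)%N ->
       row_deriv X i.-1 j <= row_deriv X i j) /\
    (forall j : nat, (1 <= j <= i.-1 + m)%N ->
       row_deriv X i j.+1 <= row_deriv X i.-1 j).

(* Tuples are indexed from 0: lambda_j is [lam`_j.-1] for 1 <= j. *)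
Definition SC (R : realType) (n m : nat) (lam : (n + m).-tuple R)
    (lamb : m.-tuple R) : set (array R n m) :=
  fun X : array R n m =>
    [/\ strip_concave X,
        forall i : nat, (i <= n)%N -> entry X i 0 = 0,
        forall j : nat, (1 <= j <= n + m)%N -> row_deriv X n j = lam`_j.-1
      & forall j : nat, (1 <= j <= m)%N -> row_deriv X 0 j = lamb`_j.-1].

(* Vertices as the points that are no proper convex combination of two distinct
   points of P. *)
Definition vertices (R : realType) (E : lmodType R) (P : set E) : set E :=
  fun x : E => P x /\
    forall (y z : E) (t : R), P y -> P z -> 0 < t < 1 ->
      x = t *: y + (1 - t) *: z -> y = z.

(* lambda_0, lambda_1, ..., with lambda_0 := lambda_1 (which is [lam`_0]) and
   the default value 0 of [nth] giving lambda_{n+m+1} := 0; likewise for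
   lambda-bar, where lambda-bar_0 := lambda_1 and lambda-bar_{m+1} := 0. *)
Definition lam_ext (R : realType) (n m : nat) (lam : (n + m).-tuple R)
    (j : nat) : R :=
  (lam`_0 :: lam)`_j.
Definition lamb_ext (R : realType) (n m : nat) (lam : (n + m).-tuple R)
    (lamb : m.-tuple R) (j : nat) : R :=
  (lam`_0 :: lamb)`_j.

Definition lam_nodes (R : realType) (n m : nat) (lam : (n + m).-tuple R) :
    {set node n m} :=
  [set v : node n m | [&& row_of v == n, (1 <= col_of v)%N
    & lam_ext lam (col_of v).+1 < lam_ext lam (col_of v)]]%SET.
Definition lamb_nodes (R : realType) (n m : nat) (lam : (n + m).-tuple R)
    (lamb : m.-tuple R) : {set node n m} :=
  [set v : node n m | (row_of v == 0%N) &&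
    (lamb_ext lam lamb (col_of v).+1 < lamb_ext lam lamb (col_of v))]%SET.

(* The edges e^0_{ij} (same column) and e^1_{ij} (next column) of H_{n,m}; the
   target of such a pair always lies in V when i < n. *)
Definition H_edges (n m : nat) : {set node n m * node n m} :=
  [set e : node n m * node n m | (row_of e.2 == (row_of e.1).+1) &&
    ((col_of e.2 == col_of e.1) || (col_of e.2 == (col_of e.1).+1))]%SET.

Record digraph (n m : nat) := Digraph {
  nodes : {set node n m};
  edges : {set node n m * node n m} }.

Definition is_subgraph (n m : nat) (H : digraph n m) : Prop :=
  (edges H \subset H_edges n m) /\
  (forall e : node n m * node n m, e \in edges H ->
     (e.1 \in nodes H) && (e.2 \in nodes H)).

Definition uadj (n m : nat) (H : digraph n m) : rel (node n m) :=
  fun u v : node n m => ((u, v) \in edges H) || ((v, u) \in edges H).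

(* H_{n,m} has neither loops nor antiparallel edges, so the underlying
   undirected graph of a subgraph is simple and its circuits have length at
   least 3. *)
Definition is_forest (n m : nat) (H : digraph n m) : Prop :=
  is_subgraph H /\
  (forall c : seq (node n m), (3 <= size c)%N -> ~ ucycle (uadj H) c).

Definition roots (n m : nat) (H : digraph n m) : {set node n m} :=
  [set v in nodes H | [forall u, (u, v) \notin edges H]]%SET.
Definition leaves (n m : nat) (H : digraph n m) : {set node n m} :=
  [set v in nodes H | [forall u, (v, u) \notin edges H]]%SET.

Definition component (n m : nat) (H : digraph n m) (v : node n m) :
    {set node n m} :=
  [set w in nodes H | connect (uadj H) v w]%SET.
Definition components (n m : nat) (H : digraph n m) : {set {set node n m}} :=
  [set component H v | v in nodes H]%SET.

Definition delete_edge (n m : nat) (H : digraph n m)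
    (e : node n m * node n m) : digraph n m :=
  Digraph (nodes H) (edges H :\ e)%SET.

Definition excess (R : realType) (n m : nat) (lam : (n + m).-tuple R)
    (lamb : m.-tuple R) (Q : {set node n m}) : R :=
  \sum_(v in Q | row_of v == n)
     (lam_ext lam (col_of v) - lam_ext lam (col_of v).+1)
  - \sum_(v in Q | row_of v == 0%N)
     (lamb_ext lam lamb (col_of v) - lamb_ext lam lamb (col_of v).+1).

Definition admissible_forests (R : realType) (n m : nat)
    (lam : (n + m).-tuple R) (lamb : m.-tuple R) : set (digraph n m) :=
  fun H : digraph n m =>
    [/\ is_forest H,
        roots H = lamb_nodes lam lamb,
        leaves H = lam_nodes lam,
        forall Q : {set node n m}, Q \in components H -> excess lam lamb Q = 0
      & forall u v : node n m, (u, v) \in edges H ->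
          0 < excess lam lamb (component (delete_edge H (u, v)) v)].

Definition is_rooted_tree (n m : nat) (H : digraph n m) : Prop :=
  [/\ is_forest H,
      forall u v : node n m, u \in nodes H -> v \in nodes H ->
        connect (uadj H) u v
    & roots H = [set origin n m]%SET].

(* The row derivative with the conventions dx_{i0} := lambda_1 and
   dx_{i,i+m+1} := 0. *)
Definition row_deriv_ext (R : realType) (n m : nat) (lam : (n + m).-tuple R)
    (X : array R n m) (i j : nat) : R :=
  if j == 0%N then lam`_0
  else if (j <= i + m)%N then row_deriv X i j
  else 0.

(* gamma(X); meaningful on the edges of H_{n,m} only. *)
Definition flow (R : realType) (n m : nat) (lam : (n + m).-tuple R)
    (X : array R n m) (e : node n m * node n m) : R :=
  let i := row_of e.1 in
  let j := col_of e.1 in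
  if col_of e.2 == j
  then row_deriv_ext lam X i j - row_deriv_ext lam X i.+1 j.+1
  else row_deriv_ext lam X i.+1 j.+1 - row_deriv_ext lam X i j.+1.

Definition flow_support (R : realType) (n m : nat) (lam : (n + m).-tuple R)
    (X : array R n m) : digraph n m :=
  let E := [set e in H_edges n m | 0 < flow lam X e]%SET in
  Digraph ([set e.1 | e in E] :|: [set e.2 | e in E])%SET E.

(* Main.v *)
Require Import Defs.
From mathcomp Require Import all_boot all_order all_algebra.
From mathcomp Require Import all_classical reals.
From mathcomp Require Import zify ring lra.

Set Implicit Arguments.
Unset Strict Implicit.
Unset Printing Implicit Defensive.

Import Order.TTheory GRing.Theory Num.Theory.
Local Open Scope ring_scope.

(** The row derivatives of an array X are encoded by the flow gamma(X) on the
    arcs of H_{n,m}.  For every X the net inflow of gamma(X) at a node of an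
    inner row vanishes; for X in SC it is lambda_j - lambda_{j+1} at (n, j) and
    -(lambdabar_j - lambdabar_{j+1}) at (0, j).  Call this function on nodes the
    demand; the value ( * ) of a component is its total demand.  Conversely every
    nonnegative flow with that net inflow comes from an array in SC
    ([array_of_flow]), and an array in SC is determined by its flow
    ([flow_inj]).  Hence SC is affinely isomorphic to a polytope of nonnegative
    flows with prescribed demand, and the theorem is the classical description
    of the vertices of such a polytope by their supports.

    - If the support contains an undirected circuit, a small circulation along
      it can be added and subtracted, so the point is not a vertex
      ([cycle_circulation], [vertex_forest]).

    - If the support lies in a forest, cutting the forest at an arc (u, v)
      leaves a component of v which that arc alone enters or leaves, so the flow
      on the arc equals the total demand of this component ([forest_flow]).
      Thus the forest determines the flow.  This gives the injectivity of the
      correspondence, shows that a point whose support is a forest is a vertex,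
      and explains the positivity condition: it says that the flow is positive
      on the arcs of the support.

    - Given an admissible forest, the totals just described define a positive
      function on its arcs.  It is a flow with the right demand because the
      component of a node w splits into w and the branches hanging off w
      ([sum_branches], [forest_flow_exists]).  At a node outside the forest the
      demand has to vanish.  On the bottom row this is the condition on the
      leaves.  On the top row the condition on the roots gives only an
      inequality, and equality follows because the demands add up to zero both
      over the forest and over all nodes ([admissible_demand_out]).

    For m = 0 the top row is the single node (0, 0), the only node of negative
    demand.  Following arcs upwards from any node of an admissible forest
    leads to it, so the forest is connected.  In a rooted tree, cutting an arc
    separates (0, 0) from the head of the arc, while following arcs downwards
    from the head leads to a leaf on its own side; the component cut off
    therefore has positive total demand. *)

(** * Branches of an undirected graph at a node *)

Section Branches.
Variables (T : finType) (e : rel T).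

Definition del_edge (u v : T) : rel T := fun x y =>
  e x y && ~~ ((x == u) && (y == v) || (x == v) && (y == u)).

Definition branch (u v : T) : {set T} :=
  [set y | connect (del_edge u v) v y]%SET.

(** In an acyclic graph the branches at [w] are connected components of the
    graph without the node [w].  Unlike [del_edge w x], this relation does not
    depend on the neighbour [x], so that different branches at [w] can be
    compared. *)
Definition avoid (w : T) : rel T := fun x y => [&& e x y, x != w & y != w].

Hypothesis e_sym : symmetric e.

Lemma del_edgeC u v : del_edge u v =2 del_edge v u.
Proof. by move=> x y; rewrite /del_edge orbC. Qed.

Lemma del_edge_sym u v : symmetric (del_edge u v).
Proof.
move=> x y; rewrite /del_edge e_sym; congr (_ && ~~ _).
by rewrite orbC; congr (_ || _); rewrite andbC.
Qed.

Lemma avoid_sym w : symmetric (avoid w).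
Proof. by move=> x y; rewrite /avoid e_sym; congr (_ && _); rewrite andbC. Qed.

Lemma sub_del_edge u v : subrel (del_edge u v) e.
Proof. by move=> x y /andP[]. Qed.

Lemma sub_avoid_del_edge w u : subrel (avoid w) (del_edge w u).
Proof.
move=> x y /and3P[exy xw yw].
by rewrite /del_edge exy (negPf xw) (negPf yw) andbF.
Qed.

Hypothesis e_irr : irreflexive e.
Hypothesis e_acyclic : forall c : seq T, (3 <= size c)%N -> ~ ucycle e c.

(** A path from [v] back to [u] that does not use the edge would close up with
    it to a circuit; having no loop and no repeated edge, it has length at least
    three. *)
Lemma bridge u v : e u v -> u \notin branch u v.
Proof.
move=> euv; rewrite inE; apply/negP.
case/connectP => p0 /shortenP[[|x [|y p]]] /=.
- by move=> _ _ _ uv; move: euv; rewrite uv e_irr.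
- move=> + _ _ ux; rewrite -ux andbT.
  by move=> /andP[_ /negP[]]; rewrite !eqxx orbT.
move=> /and3P[vx xy yp] uq _ uE.
apply: (@e_acyclic (v :: x :: y :: p)) => //; apply/andP; split=> //=.
rewrite (sub_del_edge vx) (sub_del_edge xy) rcons_path -uE euv andbT /=.
exact: sub_path (@sub_del_edge u v) _ _ yp.
Qed.

(** A path that leaves [x] without the edge to [w] can never reach [w], the
    edge being a bridge. *)
Lemma branchE w x : e w x -> branch w x = [set y | connect (avoid w) x y]%SET.
Proof.
move=> ewx; apply/setP => y; rewrite !inE; apply/idP/idP; last first.
  by apply: connect_sub => a b /(@sub_avoid_del_edge w x)/connect1; apply.
case/connectP => p + ->; elim/last_ind: p => // p z IHp.
rewrite rcons_path last_rcons => /andP[xp pz].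
apply: connect_trans (IHp xp) (connect1 _).
rewrite /avoid (sub_del_edge pz) /=; apply/andP; split; apply/eqP => wE;
  move/negP: (bridge ewx); apply; rewrite inE -[X in connect _ _ X]wE.
  by apply/connectP; exists p.
apply/connectP; exists (rcons p z); last by rewrite last_rcons.
by rewrite rcons_path xp.
Qed.

Lemma branch_exists w y : connect e w y -> y != w ->
  exists2 x, e w x & y \in branch w x.
Proof.
case/connectP => p0 /shortenP[[|x p']] /=; first by move=> _ _ _ -> /eqP.
move=> /andP[wx xp] /andP[wp _] _ yE yw; exists x => //.
rewrite branchE // inE; apply/connectP; exists p' => //.
move: wp xp; clear; elim: p' x => //= z p IHp x.
rewrite !inE !negb_or => /and3P[wx wz wp] /andP[xz zp].
by rewrite /avoid xz eq_sym wx eq_sym wz /= IHp // inE negb_or wz.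
Qed.

(** If two branches met, their tips [x1] and [x2] would be joined by a path
    avoiding [w], and the edge from [w] to [x1] would not be a bridge. *)
Lemma branch_uniq w x1 x2 y : e w x1 -> e w x2 ->
  y \in branch w x1 -> y \in branch w x2 -> x1 = x2.
Proof.
move=> e1 e2; rewrite !branchE // !inE => c1 c2; apply/eqP/negPn/negP => x12.
have c12 : connect (avoid w) x1 x2.
  by apply: connect_trans c1 _; rewrite (sym_connect_sym (@avoid_sym w)).
move/negP: (bridge e1); apply; rewrite inE; apply: connect_trans (connect1 _).
  by apply: connect_sub c12 => a b /(@sub_avoid_del_edge w x1)/connect1.
rewrite /del_edge e_sym e2 eqxx andbT [x2 == x1]eq_sym (negPf x12) orbF /=.
by apply/negP => /andP[/eqP x2w /eqP wx1]; rewrite -wx1 x2w eqxx in x12.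
Qed.

Lemma branch_notin w x y : e w x -> y \in branch w x -> y != w.
Proof. by move=> ewx; apply: contraTneq => ->; exact: bridge. Qed.

(** Every node of the component other than [w] lies in exactly one branch: the
    one through which a simple path from [w] to it begins. *)
Lemma sum_branches (V : zmodType) (f : T -> V) w :
  \sum_(y | connect e w y) f y =
  f w + \sum_(x | e w x) \sum_(y in branch w x) f y.
Proof.
rewrite (bigD1 w) ?connect0 //=; congr (_ + _).
rewrite (exchange_big_dep (fun y => connect e w y && (y != w))) /=; last first.
  move=> x y ewx yx; rewrite (branch_notin ewx yx) andbT.
  apply: connect_trans (connect1 ewx) _; move: yx; rewrite inE.
  by apply: connect_sub => a b /sub_del_edge/connect1.
apply: eq_bigr => y /andP[cy yw]; have [x ewx yx] := branch_exists cy yw.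
rewrite (big_pred1 x) // => z; apply/andP/eqP => [[ewz yz]|->//].
exact: branch_uniq yz yx.
Qed.

Lemma sum_bridge (V : zmodType) (f : T -> V) u v : e u v ->
  \sum_(y | connect e v y) f y =
  \sum_(y in branch u v) f y + \sum_(y in branch v u) f y.
Proof.
move=> euv; have evu : e v u by rewrite e_sym.
have vE y : (y \in branch v u) = connect (del_edge u v) u y.
  by rewrite inE; apply: eq_connect; apply: del_edgeC.
have dis y : y \in branch u v -> y \notin branch v u.
  move=> yv; rewrite vE; apply/negP => yu; move/negP: (bridge euv); apply.
  move: yv; rewrite !inE => yv; apply: connect_trans yv _.
  by rewrite (sym_connect_sym (@del_edge_sym u v)).
have cE y : connect e v y = (y \in branch u v) || (y \in branch v u).
  apply/idP/idP; last first.
    case/orP; rewrite ?vE ?inE => c; last apply: connect_trans (connect1 evu) _;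
      by apply: connect_sub c => a b /sub_del_edge/connect1.
  case/connectP => p + ->; elim/last_ind: p => [_|p z IHp].
    by rewrite inE connect0.
  rewrite rcons_path last_rcons => /andP[/IHp vp pz].
  have [duv|] := boolP (del_edge u v (last v p) z).
    move: vp; rewrite !vE !inE => /orP[] vp;
      by rewrite (connect_trans vp (connect1 duv)) ?orbT.
  rewrite /del_edge pz /= => /negPn/orP[] /andP[_ /eqP ->];
    by rewrite vE inE connect0 ?orbT.
rewrite (eq_bigl _ _ cE) (bigID (mem (branch u v))) /=; congr (_ + _).
  by apply: eq_bigl => y; case: (y \in branch u v); rewrite ?andbT ?andbF.
apply: eq_bigl => y; have := dis y; case: (y \in branch u v) => /=.
  by move=> /(_ isT)/negPf ->.
by rewrite andbT.
Qed.

End Branches.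

(** * Flows on oriented graphs *)

Section Flows.
Variables (T : finType) (E : {set T * T}).

(** With [E := edges H], this is convertible to [uadj H]. *)
Definition und : rel T := fun u v => ((u, v) \in E) || ((v, u) \in E).

Definition acyclic : Prop :=
  forall c : seq T, (3 <= size c)%N -> ~ ucycle und c.

Hypothesis E_oriented : forall u v, (u, v) \in E -> (v, u) \notin E.

Lemma und_sym : symmetric und.
Proof. by move=> u v; rewrite /und orbC. Qed.

Lemma und_irr : irreflexive und.
Proof.
by move=> u; rewrite /und orbb; apply/negP => uu; move: (E_oriented uu); rewrite uu.
Qed.

Lemma und_del_arc u v : (u, v) \in E ->
  (fun x y => ((x, y) \in E :\ (u, v)) || ((y, x) \in E :\ (u, v)))%SET
    =2 del_edge und u v.
Proof.
move=> uvE x y; rewrite /del_edge /und !inE !xpair_eqE.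
rewrite ![(y == _) && _]andbC.
have [/andP[/eqP-> /eqP->]|_] /= := boolP ((x == u) && (y == v)).
  by rewrite (negPf (E_oriented uvE)) !andbF.
have [/andP[/eqP-> /eqP->]|_] /= := boolP ((x == v) && (y == u)).
  by rewrite (negPf (E_oriented uvE)) !andbF.
by rewrite andbT.
Qed.

Variable V : zmodType.
Implicit Types (g : T * T -> V) (a : T -> V).

Definition netflow g (w : T) : V :=
  \sum_(x in E | x.2 == w) g x - \sum_(x in E | x.1 == w) g x.

Lemma netflow_arcs g w :
  netflow g w = \sum_(u | (u, w) \in E) g (u, w) -
                \sum_(v | (w, v) \in E) g (w, v).
Proof.
rewrite /netflow; congr (_ - _).
  rewrite (reindex_onto (fun u => (u, w)) fst) /=; last first.
    by move=> [x y] /= /andP[_ /eqP->].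
  by apply: eq_bigl => u; rewrite !eqxx !andbT.
rewrite (reindex_onto (fun u => (w, u)) snd) /=; last first.
  by move=> [x y] /= /andP[_ /eqP->].
by apply: eq_bigl => u; rewrite !eqxx !andbT.
Qed.

(** An arc with both ends in [Q] is counted once with each sign. *)
Lemma sum_netflow g (Q : {set T}) :
  \sum_(w in Q) netflow g w =
  \sum_(x in E | (x.2 \in Q) && (x.1 \notin Q)) g x -
  \sum_(x in E | (x.1 \in Q) && (x.2 \notin Q)) g x.
Proof.
have endE (p : T * T -> T) : \sum_(w in Q) \sum_(x in E | p x == w) g x =
    \sum_(x in E | p x \in Q) g x.
  rewrite (exchange_big_dep (fun x => (x \in E) && (p x \in Q))) /=.
    apply: eq_bigr => x /andP[xE xQ].
    by rewrite (big_pred1 (p x)) // => w; rewrite xE /= eq_sym andb_idl // => /eqP->.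
  by move=> w x wQ /andP[-> /eqP->].
rewrite sumrB !endE (bigID (fun x : T * T => x.1 \in Q)) /=.
rewrite [X in _ - X](bigID (fun x : T * T => x.2 \in Q)) /=.
rewrite (eq_bigl (fun x => (x \in E) && (x.1 \in Q) && (x.2 \in Q))); last first.
  by move=> x; rewrite -!andbA; congr (_ && _); rewrite andbC.
rewrite opprD addrACA subrr add0r.
by congr (_ - _); apply: eq_bigl => x; rewrite andbA.
Qed.

Lemma sum_netflow_component g v :
  \sum_(w | connect und v w) netflow g w = 0.
Proof.
have cl x y : (x, y) \in E -> connect und v x = connect und v y.
  move=> xyE; have xy : und x y by rewrite /und xyE.
  apply/idP/idP => c; apply: connect_trans c (connect1 _) => //.
  by rewrite und_sym.
rewrite (eq_bigl (fun w => w \in [set w | connect und v w]%SET)); last first.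
  by move=> w; rewrite inE.
rewrite sum_netflow !big_pred0 ?subr0 // => -[x y] /=; rewrite !inE;
  apply/negP => /and3P[xyE]; rewrite (cl _ _ xyE) => ->//.
Qed.

Hypothesis E_acyclic : acyclic.

(** The arc [(u, v)] is the only one with exactly one end in the branch. *)
Lemma forest_flow g u v : (u, v) \in E ->
  g (u, v) = \sum_(w in branch und u v) netflow g w.
Proof.
move=> uvE; have uv : und u v by rewrite /und uvE.
have uN : u \notin branch und u v by apply: bridge uv => //; exact: und_irr.
have vN : v \in branch und u v by rewrite inE connect0.
have cl x y : (x, y) \in E -> (x, y) != (u, v) ->
    (x \in branch und u v) = (y \in branch und u v).
  move=> xyE xyN; have xy : del_edge und u v x y.
    rewrite -und_del_arc //; apply/orP; left.
    by rewrite in_setD1 xyN.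
  rewrite !inE; apply/idP/idP => c; apply: connect_trans c (connect1 _) => //.
  by rewrite del_edge_sym //; exact: und_sym.
rewrite sum_netflow (big_pred1 (u, v)) /=.
  rewrite big_pred0 ?subr0 // => -[x y] /=.
  have [[-> ->]|xyN] := eqVneq (x, y) (u, v); first by rewrite (negPf uN) andbF.
  by apply/negP => /and3P[xyE]; rewrite (cl _ _ xyE xyN) => ->.
move=> [x y] /=; have [[-> ->]|xyN] := eqVneq (x, y) (u, v).
  by rewrite uvE uN vN.
apply/negP => /and3P[xyE].
by rewrite (cl _ _ xyE xyN) => ->.
Qed.

(** Existence of a flow with net inflow [a]: sum [a] over the component of [w],
    which is [w] together with the branches at [w].  The branch across an arc
    leaving [w] contributes the flow on that arc; the branch across an arc
    entering [w] is the complement of the one that defines the flow on that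
    arc, and contributes the opposite value. *)
Lemma forest_flow_exists a (g := fun x => \sum_(w in branch und x.1 x.2) a w) :
  (forall v, \sum_(w | connect und v w) a w = 0) -> netflow g =1 a.
Proof.
move=> a0 w; rewrite netflow_arcs; apply/eqP; rewrite -subr_eq0; apply/eqP.
have := sum_branches und_sym und_irr E_acyclic a w; rewrite a0.
rewrite (bigID (fun x => (x, w) \in E)) /=.
rewrite (eq_bigl (fun u => (u, w) \in E)); last first.
  by move=> u; rewrite /und; case: ((u, w) \in E); rewrite ?orbT ?andbF.
rewrite [X in _ + (_ + X)](eq_bigl (fun u => (w, u) \in E)); last first.
  move=> u; rewrite /und; case: (boolP ((w, u) \in E)) => /=.
    by move/E_oriented ->.
  by case: ((u, w) \in E).
rewrite [X in _ + (X + _)](_ : _ = - \sum_(u | (u, w) \in E) g (u, w)).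
  move=> h; have := congr1 -%R h; rewrite !opprD opprK oppr0 => {}h.
  by rewrite addrC [RHS]h.
rewrite -sumrN; apply: eq_bigr => u uwE; rewrite /g /=; apply/eqP.
have uw : und u w by rewrite /und uwE.
rewrite -addr_eq0 addrC -(sum_bridge und_sym und_irr) ?a0 //.
Qed.

End Flows.

Lemma netflowD (T : finType) (E : {set T * T}) (V : zmodType)
    (g h : T * T -> V) w :
  netflow E (fun x => g x + h x) w = netflow E g w + netflow E h w.
Proof. by rewrite /netflow !big_split /= opprD addrACA. Qed.

Lemma netflowZ (T : finType) (E : {set T * T}) (V : pzRingType) (s : V)
    (g : T * T -> V) w :
  netflow E (fun x => s * g x) w = s * netflow E g w.
Proof. by rewrite /netflow -!mulr_sumr -mulrBr. Qed.

Lemma eq_netflow (T : finType) (E : {set T * T}) (V : zmodType)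
    (g h : T * T -> V) :
  {in E, g =1 h} -> netflow E g =1 netflow E h.
Proof.
by move=> gh w; rewrite /netflow; congr (_ - _); apply: eq_bigr => x /andP[xE _];
  exact: gh.
Qed.

Lemma netflow_sub (T : finType) (E E' : {set T * T}) (V : zmodType)
    (g : T * T -> V) :
  E' \subset E -> (forall x, x \in E -> x \notin E' -> g x = 0) ->
  netflow E g =1 netflow E' g.
Proof.
move=> sE g0 w; rewrite /netflow.
have aux (p : T * T -> T) : \sum_(x in E | p x == w) g x =
    \sum_(x in E' | p x == w) g x.
  rewrite (bigID (mem E')) /= addrC big1 ?add0r; last first.
    by move=> x /andP[/andP[xE _] xE']; exact: g0.
  apply: eq_bigl => x; rewrite andbAC; congr (_ && _).
  by rewrite andb_idl // => /(fintype.subsetP sE).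
by rewrite !aux.
Qed.

(** The circulation is 1 on the arcs which the circuit traverses forwards, -1 on
    those which it traverses backwards and 0 elsewhere.  The bound on the length
    ensures that no arc is traversed in both directions. *)
Lemma cycle_circulation (T : finType) (E : {set T * T}) (V : pzRingType)
    (c : seq T) :
  (forall u v, (u, v) \in E -> (v, u) \notin E) ->
  (3 <= size c)%N -> ucycle (und E) c ->
  exists d : T * T -> V, netflow E d =1 (fun=> 0) /\
    exists2 x, x \in E & (d x == 1) || (d x == -1).
Proof.
move=> Eor c3 /andP[cyc uq].
(* [s u v] holds when the circuit steps from [u] to [v]. *)
pose s u v := (u \in c) && (next c u == v).
exists (fun x => (s x.1 x.2)%:R - (s x.2 x.1)%:R); split.
  move=> w; rewrite netflow_arcs /=.
  have sE u v : s u v -> und E u v.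
    by move=> /andP[uc /eqP <-]; exact: next_cycle.
  set f := fun u => (s u w)%:R - (s w u)%:R : V.
  rewrite [X in _ - X](eq_bigr (fun v => - f v)); last first.
    by move=> v _; rewrite /f opprB.
  rewrite sumrN opprK.
  have -> : \sum_(u | (u, w) \in E) f u + \sum_(v | (w, v) \in E) f v =
      \sum_u f u.
    rewrite [RHS](bigID (fun u => (u, w) \in E)) /=; congr (_ + _).
    rewrite [RHS](bigID (fun u => (w, u) \in E)) /= [X in _ = _ + X]big1 ?addr0.
      apply: eq_bigl => u; case: (boolP ((w, u) \in E)); last by rewrite andbF.
      by move/Eor => ->.
    move=> u /andP[uw wu]; rewrite /f.
    have -> : s u w = false.
      by apply/negP => /sE; rewrite /und (negPf uw) (negPf wu).
    have -> : s w u = false.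
      by apply/negP => /sE; rewrite /und (negPf uw) (negPf wu).
    by rewrite subrr.
  rewrite sumrB; apply/eqP; rewrite subr_eq0; apply/eqP.
  (* The circuit enters [w] exactly as often as it leaves it. *)
  have [wc|wc] := boolP (w \in c).
    rewrite (bigD1 (prev c w)) //= big1 => [|u up].
      rewrite (bigD1 (next c w)) //= big1 => [|u up].
        by rewrite /s mem_prev wc next_prev // !eqxx.
      by rewrite /s eq_sym (negPf up) andbF.
    rewrite /s; case: eqP => [nE|]; last by rewrite andbF.
    by move: up; rewrite -nE prev_next // eqxx.
  rewrite !big1 // => u _; rewrite /s ?(negPf wc) //.
  case: eqP => [nE|]; last by rewrite andbF.
  by rewrite -(mem_next c) nE (negPf wc).
(* Any step of the circuit gives an arc of nonzero value; take the first. *)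
case: c => [|x [|y [|z c]]] // in c3 cyc uq s *.
have sxy : s x y by rewrite /s !inE eqxx /= eqxx.
have syx : s y x = false.
  rewrite /s !inE eqxx orbT /=; move: uq; rewrite /= !inE !negb_or.
  case/andP => /and3P[xy xz _] _; rewrite [y == x]eq_sym (negPf xy) eqxx.
  by apply/negP => /eqP zx; rewrite zx eqxx in xz.
have : und E x y by case/andP: cyc.
case/orP => xyE; [exists (x, y)|exists (y, x)] => //=;
  by rewrite sxy syx ?subr0 ?sub0r eqxx ?orbT.
Qed.

(** * The arcs of the trapezoidal digraph *)

Section Trapezoid.
Variables n m : nat.
Implicit Types u v w : node n m.

(** Any pair of naturals is accepted, to keep index arithmetic free of proofs;
    outside of the trapezoid the value is junk. *)
Definition vtx (i j : nat) : node n m :=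
  insubd (origin n m) (inord i : 'I_n.+1, inord j : 'I_(n + m).+1).

Lemma row_le v : (row_of v <= n)%N.
Proof. by rewrite -ltnS ltn_ord. Qed.

Lemma col_le v : (col_of v <= row_of v + m)%N.
Proof. exact: (valP v). Qed.

Lemma node_eq u v : row_of u = row_of v -> col_of u = col_of v -> u = v.
Proof.
move=> r c; apply: val_inj; case: u v r c => [[a b] ?] [[a' b'] ?] /=.
by rewrite /row_of /col_of /= => /val_inj -> /val_inj ->.
Qed.

Lemma val_vtx i j : (i <= n)%N -> (j <= i + m)%N ->
  val (vtx i j) = (inord i, inord j).
Proof.
move=> i_n j_i; rewrite val_insubd /= !inordK ?j_i // ltnS.
by rewrite (leq_trans j_i) // leq_add2r.
Qed.

Lemma row_vtx i j : (i <= n)%N -> (j <= i + m)%N -> row_of (vtx i j) = i.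
Proof. by move=> i_n j_i; rewrite /row_of val_vtx //= inordK. Qed.

Lemma col_vtx i j : (i <= n)%N -> (j <= i + m)%N -> col_of (vtx i j) = j.
Proof.
move=> i_n j_i; rewrite /col_of val_vtx //= inordK // ltnS.
by rewrite (leq_trans j_i) // leq_add2r.
Qed.

Lemma vtxK v : vtx (row_of v) (col_of v) = v.
Proof.
have rn := row_le v; have cr := col_le v.
by apply: node_eq; rewrite ?row_vtx ?col_vtx.
Qed.

Lemma sum_row (V : nmodType) (F : nat -> V) i : (i <= n)%N ->
  \sum_(v : node n m | row_of v == i) F (col_of v) =
  \sum_(0 <= j < (i + m).+1) F j.
Proof.
move=> i_n; rewrite big_mkord.
rewrite (reindex_onto (fun j : 'I_(i + m).+1 => vtx i j)
                      (fun v => inord (col_of v))) /=; last first.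
  move=> v /eqP rv; have cv := col_le v; rewrite inordK; last by rewrite ltnS -rv.
  by rewrite -rv vtxK.
apply: eq_big => j; have ji : (j <= i + m)%N by rewrite -ltnS.
  by rewrite row_vtx // col_vtx // inord_val !eqxx.
by rewrite col_vtx.
Qed.

Lemma H_edgesE u v : ((u, v) \in H_edges n m) =
  (row_of v == (row_of u).+1) &&
  ((col_of v == col_of u) || (col_of v == (col_of u).+1)).
Proof. by rewrite inE. Qed.

Lemma H_edge0 i j : (i < n)%N -> (j <= i + m)%N ->
  (vtx i j, vtx i.+1 j) \in H_edges n m.
Proof. by move=> i_n ji; rewrite H_edgesE !row_vtx ?col_vtx ?eqxx //; lia. Qed.

Lemma H_edge1 i j : (i < n)%N -> (j <= i + m)%N ->
  (vtx i j, vtx i.+1 j.+1) \in H_edges n m.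
Proof.
by move=> i_n ji; rewrite H_edgesE !row_vtx ?col_vtx ?eqxx ?orbT //; lia.
Qed.

Lemma H_edgesP (P : node n m * node n m -> Prop) :
  (forall i j, (i < n)%N -> (j <= i + m)%N -> P (vtx i j, vtx i.+1 j)) ->
  (forall i j, (i < n)%N -> (j <= i + m)%N -> P (vtx i j, vtx i.+1 j.+1)) ->
  forall x, x \in H_edges n m -> P x.
Proof.
move=> P0 P1 [u v]; rewrite H_edgesE => /andP[/eqP r].
have rv := row_le v; have cu := col_le u; rewrite r in rv.
by case/orP => /eqP c; rewrite -(vtxK u) -(vtxK v) r c; [exact: P0|exact: P1].
Qed.

Section Netflow.
Variables (V : zmodType) (g : node n m * node n m -> V).

Definition outflow i j := g (vtx i j, vtx i.+1 j) + g (vtx i j, vtx i.+1 j.+1).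

(** The first term is the arc e^0 into [(i, j)], missing at the right end of the
    row, and the second the arc e^1, missing in column 0.  Meaningful for
    [0 < i]. *)
Definition inflow i j :=
  (if (j <= i.-1 + m)%N then g (vtx i.-1 j, vtx i j) else 0) +
  (if (0 < j)%N then g (vtx i.-1 j.-1, vtx i j) else 0).

Lemma sum_outflow i j : (i <= n)%N -> (j <= i + m)%N ->
  \sum_(v | (vtx i j, v) \in H_edges n m) g (vtx i j, v) =
  if (i < n)%N then outflow i j else 0.
Proof.
move=> i_n ji; case: ltnP => [lt_in|ge_in]; last first.
  apply: big_pred0 => v; rewrite H_edgesE row_vtx //.
  by have := row_le v; case: eqP => //; lia.
have j1 : (j <= i.+1 + m)%N by lia.
have j2 : (j.+1 <= i.+1 + m)%N by lia.
rewrite (bigD1 (vtx i.+1 j)) /=; last by exact: H_edge0.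
rewrite (big_pred1 (vtx i.+1 j.+1)) // => v.
rewrite H_edgesE row_vtx // col_vtx //.
apply/andP/eqP => [[/andP[/eqP r /orP[]/eqP c]]|->].
- by rewrite -(vtxK v) r c eqxx.
- by rewrite -(vtxK v) r c.
rewrite row_vtx // col_vtx // !eqxx orbT; split=> //; apply/eqP.
by move=> /(congr1 (@col_of _ _)); rewrite !col_vtx //; lia.
Qed.

Lemma sum_inflow i j : (i <= n)%N -> (j <= i + m)%N ->
  \sum_(u | (u, vtx i j) \in H_edges n m) g (u, vtx i j) =
  if (0 < i)%N then inflow i j else 0.
Proof.
move=> i_n ji; case: ltnP => [lt_0i|]; last first.
  rewrite leqn0 => /eqP i0; apply: big_pred0 => u.
  by rewrite H_edgesE row_vtx // i0.
case: i lt_0i i_n ji => // i _ i_n ji; rewrite /inflow /=.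
rewrite (bigID (fun u => col_of u == j)) /=; congr (_ + _).
  case: leqP => [le_j|gt_j].
    apply: big_pred1 => u; rewrite H_edgesE row_vtx // col_vtx //.
    apply/andP/eqP => [[/andP[/eqP [r] _] /eqP c]|->].
      by rewrite -(vtxK u) -r c.
    by rewrite row_vtx ?col_vtx ?eqxx //; lia.
  apply: big_pred0 => u; rewrite H_edgesE row_vtx // col_vtx //.
  apply/negP => /andP[/andP[/eqP r _] /eqP c].
  by have := col_le u; lia.
case: ltnP => [lt_0j|].
  apply: big_pred1 => u; rewrite H_edgesE row_vtx // col_vtx //.
  apply/andP/eqP => [[/andP[/eqP [r] /orP[/eqP ->|/eqP -> _]]]|->].
  - by rewrite eqxx.
  - by rewrite r /= vtxK.
  by rewrite row_vtx ?col_vtx ?prednK ?eqxx ?orbT //; try lia; split=> //; lia.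
rewrite leqn0 => /eqP j0; apply: big_pred0 => u.
rewrite H_edgesE row_vtx // col_vtx // j0.
by case: eqP => // _; rewrite (eq_sym 0%N); case: eqP.
Qed.

Lemma netflowE i j : (i <= n)%N -> (j <= i + m)%N ->
  netflow (H_edges n m) g (vtx i j) =
  (if (0 < i)%N then inflow i j else 0) - (if (i < n)%N then outflow i j else 0).
Proof. by move=> i_n ji; rewrite netflow_arcs sum_inflow // sum_outflow. Qed.

End Netflow.
End Trapezoid.

(** * Arrays and their flows *)

Section Arrays.
Variables (R : realType) (n m : nat) (lam : (n + m).-tuple R) (lamb : m.-tuple R).
Implicit Types (X Y Z : array R n m) (u v w : node n m).
Local Notation D := (row_deriv_ext lam).

Lemma entry_vtx X i j : (i <= n)%N -> (j <= i + m)%N ->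
  entry X i j = X (vtx n m i j).
Proof.
move=> i_n ji; rewrite /entry; case: pickP => [v /andP[/eqP <- /eqP <-]|].
  by rewrite vtxK.
by move=> /(_ (vtx n m i j)); rewrite row_vtx // col_vtx // !eqxx.
Qed.

Lemma entry_affine (t : R) Y Z i j :
  entry (t *: Y + (1 - t) *: Z) i j = t * entry Y i j + (1 - t) * entry Z i j.
Proof.
by rewrite /entry; case: pickP => [v _|_]; rewrite ?ffunE ?mulr0 ?addr0.
Qed.

Lemma row_deriv_affine (t : R) Y Z i j :
  row_deriv (t *: Y + (1 - t) *: Z) i j =
  t * row_deriv Y i j + (1 - t) * row_deriv Z i j.
Proof. by rewrite /row_deriv !entry_affine; ring. Qed.

Lemma row_deriv_ext_affine (t : R) Y Z i j :
  D (t *: Y + (1 - t) *: Z) i j = t * D Y i j + (1 - t) * D Z i j.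
Proof.
by rewrite /row_deriv_ext row_deriv_affine; case: ifP => _; [|case: ifP => _]; ring.
Qed.

Lemma flow_affine (t : R) Y Z x :
  flow lam (t *: Y + (1 - t) *: Z) x = t * flow lam Y x + (1 - t) * flow lam Z x.
Proof.
by rewrite /flow !row_deriv_ext_affine; case: ifP => _; ring.
Qed.

Lemma derivE X i j : (0 < j <= i + m)%N -> D X i j = row_deriv X i j.
Proof. by rewrite /row_deriv_ext; case: j => //= j ->. Qed.

Lemma deriv_left X i : D X i 0 = lam`_0.
Proof. by []. Qed.

Lemma deriv_right X i j : (i + m < j)%N -> D X i j = 0.
Proof. by rewrite /row_deriv_ext; case: j => // j; rewrite ltnNge => /negPf ->. Qed.

Lemma flow0 X i j : (i < n)%N -> (j <= i + m)%N ->
  flow lam X (vtx n m i j, vtx n m i.+1 j) = D X i j - D X i.+1 j.+1.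
Proof. by move=> i_n ji; rewrite /flow !row_vtx ?col_vtx ?eqxx //; lia. Qed.

Lemma flow1 X i j : (i < n)%N -> (j <= i + m)%N ->
  flow lam X (vtx n m i j, vtx n m i.+1 j.+1) = D X i.+1 j.+1 - D X i j.+1.
Proof.
move=> i_n ji; rewrite /flow !row_vtx ?col_vtx //; try lia.
by case: eqP => //; lia.
Qed.

(** Both the inflow and the outflow of gamma(X) at [(i, j)] telescope to the
    difference of consecutive row derivatives. *)
Lemma netflow_flow X i j : (i <= n)%N -> (j <= i + m)%N ->
  netflow (H_edges n m) (flow lam X) (vtx n m i j) =
  (if (0 < i)%N then D X i j - D X i j.+1 else 0) -
  (if (i < n)%N then D X i j - D X i j.+1 else 0).
Proof.
move=> i_n ji; rewrite netflowE //; congr (_ - _); last first.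
  by case: ifP => // lt_in; rewrite /outflow flow0 // flow1 //; ring.
case: i i_n ji => //= i i_n ji; rewrite /inflow /=.
have -> : (if (j <= i + m)%N then
    flow lam X (vtx n m i j, vtx n m i.+1 j) else 0) = D X i j - D X i.+1 j.+1.
  by case: leqP => jim; [rewrite flow0|rewrite !deriv_right ?subrr //; lia].
case: j ji => [|j] ji /=; first by rewrite addr0 !deriv_left.
by rewrite flow1 //; ring.
Qed.

(** The net inflow that membership in SC prescribes at [v]; the value ( * ) of a
    set of nodes is its total demand. *)
Definition demand v : R :=
  (if row_of v == n then lam_ext lam (col_of v) - lam_ext lam (col_of v).+1
   else 0) -
  (if row_of v == 0%N then
     lamb_ext lam lamb (col_of v) - lamb_ext lam lamb (col_of v).+1 else 0).

Lemma excessE (Q : {set node n m}) : excess lam lamb Q = \sum_(v in Q) demand v.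
Proof. by rewrite sumrB -!big_mkcondr. Qed.

Lemma deriv_bottom X j : SC lam lamb X -> (j <= (n + m).+1)%N ->
  D X n j = lam_ext lam j.
Proof.
case=> _ _ Xn _; case: j => // j; rewrite ltnS => jn; rewrite /lam_ext /=.
case: (ltnP j (n + m)) => [jlt|jge]; first by rewrite derivE // Xn.
by rewrite deriv_right // nth_default // size_tuple.
Qed.

Lemma deriv_top X j : SC lam lamb X -> (j <= m.+1)%N ->
  D X 0 j = lamb_ext lam lamb j.
Proof.
case=> _ _ _ X0; case: j => // j; rewrite ltnS => jn; rewrite /lamb_ext /=.
case: (ltnP j m) => [jlt|jge]; first by rewrite derivE // X0.
by rewrite deriv_right // nth_default // size_tuple.
Qed.

Lemma SC_netflow X : (0 < n)%N -> SC lam lamb X ->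
  netflow (H_edges n m) (flow lam X) =1 demand.
Proof.
move=> n0 XSC v; have cv := col_le v.
rewrite -{1}(vtxK v) netflow_flow ?row_le //.
rewrite /demand; have [r|rn] := eqVneq (row_of v) n.
  rewrite r ltnn n0 (gtn_eqF n0) !(deriv_bottom XSC) //; rewrite r in cv => //; lia.
have [r|r0] := eqVneq (row_of v) 0%N.
  by rewrite r n0 /= !(deriv_top XSC) //; rewrite r in cv => //; lia.
by rewrite lt0n r0 ltn_neqAle rn row_le subrr subr0.
Qed.

Lemma lam_nth_ge0 k : (forall i : 'I_(n + m), 0 <= tnth lam i) -> 0 <= lam`_k.
Proof.
move=> lam0; case: (ltnP k (n + m)) => [lt_k|ge_k].
  by have := lam0 (Ordinal lt_k); rewrite (tnth_nth 0).
by rewrite nth_default // size_tuple.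
Qed.

(** Inside the trapezoid this is strip-concavity.  On the arcs in column 0 and on
    those at the right end of a row it follows from strip-concavity used along
    the whole boundary, down to the bottom row, where the derivatives lie
    between 0 and lambda_1. *)
Lemma SC_flow_ge0 X : (0 < n)%N -> (forall k : 'I_(n + m), 0 <= tnth lam k) ->
  SC lam lamb X -> forall x, x \in H_edges n m -> 0 <= flow lam X x.
Proof.
move=> n0 lam0 XSC; have [Xsc _ _ _] := XSC.
have stepL i j : (i < n)%N -> (0 < j <= i + m)%N -> D X i j <= D X i.+1 j.
  move=> i_n ji; have [/(_ j ji) le _] := Xsc i.+1 i_n.
  by rewrite !derivE //; lia.
have stepR i j : (i < n)%N -> (0 < j <= i + m)%N -> D X i.+1 j.+1 <= D X i j.
  move=> i_n ji; have [_ /(_ j ji) le] := Xsc i.+1 i_n.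
  by rewrite !derivE //; lia.
have left_bnd k i : (i + k = n)%N -> (0 < i)%N -> D X i 1 <= lam`_0.
  elim: k i => [|k IHk] i ikn i0.
    have -> : i = n by lia.
    by rewrite (deriv_bottom XSC) //; lia.
  by apply: le_trans (stepL i 1%N _ _) (IHk i.+1 _ _); lia.
have right_bnd k i : (i + k = n)%N -> (0 < i)%N -> 0 <= D X i (i + m).
  elim: k i => [|k IHk] i ikn i0.
    have -> : i = n by lia.
    by rewrite (deriv_bottom XSC) // -(prednK (ltn_addr m n0)) lam_nth_ge0.
  by apply: le_trans (IHk i.+1 _ _) (stepR i (i + m)%N _ _); lia.
apply: H_edgesP => i j i_n ji.
  rewrite flow0 // subr_ge0; case: j ji => [|j] ji; last by apply: stepR.
  by rewrite deriv_left (left_bnd (n - i.+1)%N) //; lia.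
rewrite flow1 // subr_ge0; move: ji; rewrite leq_eqVlt => /orP[/eqP ->|ji].
  rewrite (@deriv_right X i) ?ltnSn // -addSn (right_bnd (n - i.+1)%N) //; lia.
by apply: stepL.
Qed.

(** The flows on the arcs e^1 determine the row derivatives from the top row
    downwards, and these determine the entries from the left. *)
Lemma flow_inj Y Z :
  (forall i, (i <= n)%N -> entry Y i 0 = entry Z i 0) ->
  (forall j, (1 <= j <= m)%N -> row_deriv Y 0 j = row_deriv Z 0 j) ->
  {in H_edges n m, flow lam Y =1 flow lam Z} -> Y = Z.
Proof.
move=> YZl YZt eqf.
have eqD i : (i <= n)%N -> forall j, (j <= (i + m).+1)%N -> D Y i j = D Z i j.
  elim: i => [_|i IHi i_n] j jm.
    case: j jm => // j; case: (ltnP m j.+1) => jm; first by rewrite !deriv_right.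
    by rewrite !derivE // YZt.
  case: j jm => // j jm; case: (ltnP (i + m) j) => ji.
    by rewrite !deriv_right //; lia.
  have := eqf _ (H_edge1 i_n ji); rewrite !flow1 // (IHi (ltnW i_n) j.+1) //.
  exact: addIr.
have eqE i j : (i <= n)%N -> (j <= i + m)%N -> entry Y i j = entry Z i j.
  move=> i_n; elim: j => [_|j IHj ji]; first exact: YZl.
  have := eqD i i_n j.+1 (ltnW _); rewrite !derivE // /row_deriv /=.
  by rewrite (IHj (ltnW ji)) => /(_ ji); exact: addIr.
apply/ffunP => v; rewrite -(vtxK v).
by rewrite -!entry_vtx ?row_le ?col_le // eqE ?row_le ?col_le.
Qed.

Lemma sum_tail (V : zmodType) (F G : nat -> V) N j :
  (forall k, (k <= N)%N -> F k = G k - G k.+1) -> (j <= N.+1)%N -> G N.+1 = 0 ->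
  \sum_(j <= k < N.+1) F k = G j.
Proof.
move=> FG jN GN; rewrite (telescope_sumr_eq (fun k => - G k)) //.
  by rewrite GN oppr0 sub0r opprK.
by move=> k kN; rewrite FG 1?addrC ?opprK //; lia.
Qed.

(** The row derivative at [(i, j)] is recovered as the total flow through the
    nodes [(i, k)] with [j <= k].  From [(i, j + 1)] to [(i + 1, j + 1)] this
    suffix sum grows by the flow on e^1_{ij}, and from [(i, j)] to
    [(i + 1, j + 1)] it drops by the flow on e^0_{ij}, as gamma requires.
    The total over a whole row does not depend on the row, which gives the
    conventional value lambda_1 in column 0. *)
Lemma array_of_flow (g : node n m * node n m -> R) : (0 < n)%N ->
  (forall x, x \in H_edges n m -> 0 <= g x) ->
  netflow (H_edges n m) g =1 demand ->
  exists2 X, SC lam lamb X & {in H_edges n m, flow lam X =1 g}.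
Proof.
move=> n0 g0 gd.
(* Below the top row this is also the inflow, as the demand of inner nodes is 0;
   the bottom row has no outflow. *)
pose thru i k := if (i < n)%N then outflow g i k else inflow g i k.
pose d i j := \sum_(j <= k < (i + m).+1) thru i k.
have thru_in i k : (0 < i <= n)%N -> (k <= i + m)%N -> thru i k = inflow g i k.
  move=> /andP[i0 i_n] ki; rewrite /thru; case: ltnP => // lt_in.
  have := gd (vtx n m i k); rewrite netflowE // lt_in i0 /demand row_vtx //.
  rewrite (ltn_eqF lt_in) (gtn_eqF i0) subrr => /eqP.
  by rewrite subr_eq0 => /eqP.
have d_top j : (j <= m.+1)%N -> d 0%N j = lamb_ext lam lamb j.
  move=> jm; apply: sum_tail => // [k km|].
    have := gd (vtx n m 0 k); rewrite netflowE // n0 /demand row_vtx // col_vtx //.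
    by rewrite (ltn_eqF n0) eqxx /= !sub0r /thru n0 => /oppr_inj.
  by rewrite /lamb_ext /= nth_default // size_tuple.
have d_bottom j : (j <= (n + m).+1)%N -> d n j = lam_ext lam j.
  move=> jm; apply: sum_tail => // [k km|].
    have := gd (vtx n m n k); rewrite netflowE // n0 /demand row_vtx // col_vtx //.
    by rewrite (gtn_eqF n0) eqxx /= !ltnn !subr0 /thru ltnn.
  by rewrite /lam_ext /= nth_default // size_tuple.
have d_end i j : (i + m < j)%N -> d i j = 0 by move=> ji; rewrite /d big_geq.
have d_diff i j : (j <= i + m)%N -> d i j = thru i j + d i j.+1.
  by move=> ji; rewrite /d big_ltn.
(* Going down one row, the suffix sums differ by the flow on the one arc that
   enters the suffix from outside. *)
have d1 i j : (i < n)%N -> (j <= i + m)%N ->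
    d i.+1 j.+1 = d i j.+1 + g (vtx n m i j, vtx n m i.+1 j.+1).
  move=> i_n; move eqk : (i + m - j)%N => k; elim: k j eqk => [|k IHk] j jk ji.
    have {jk} -> : j = (i + m)%N by lia.
    rewrite (d_end i) // add0r d_diff // d_end // addr0 thru_in // /inflow /=.
    by rewrite ltnn add0r.
  rewrite d_diff; last by lia.
  rewrite IHk ?(d_diff i j.+1); try lia.
  rewrite thru_in; try lia; rewrite /inflow /thru i_n /outflow /=.
  have -> : (j < i + m)%N by lia.
  by ring.
have d_left i : (i <= n)%N -> d i 0%N = lam`_0.
  elim: i => [_|i IHi i_n]; first by rewrite d_top.
  rewrite -(IHi (ltnW i_n)) d_diff // d1 // thru_in // (d_diff i 0%N) // /thru i_n.
  by rewrite /inflow /outflow /=; ring.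
pose X : array R n m :=
  [ffun v => \sum_(1 <= l < (col_of v).+1) d (row_of v) l].
have Xe i j : (i <= n)%N -> (j <= i + m)%N ->
    entry X i j = \sum_(1 <= l < j.+1) d i l.
  by move=> i_n ji; rewrite entry_vtx // ffunE row_vtx // col_vtx.
have Xd i j : (i <= n)%N -> (0 < j <= i + m)%N -> row_deriv X i j = d i j.
  case: j => // j i_n /= ji; rewrite /row_deriv /= !Xe //; try lia.
  by rewrite big_nat_recr //= addrAC subrr add0r.
have XD i j : (i <= n)%N -> D X i j = d i j.
  move=> i_n; case: j => [|j]; first by rewrite deriv_left d_left.
  case: (ltnP (i + m) j.+1) => ji; first by rewrite deriv_right // d_end.
  by rewrite derivE // Xd.
have Xg : {in H_edges n m, flow lam X =1 g}.
  apply: H_edgesP => i j i_n ji.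
    rewrite flow0 // !XD ?(ltnW i_n) // d1 // (d_diff i) // /thru i_n /outflow.
    by ring.
  by rewrite flow1 // !XD ?(ltnW i_n) // d1 //; ring.
exists X => //; split.
- case=> // i i_n /=; split=> j ji.
    rewrite -subr_ge0 -!derivE //; try lia.
    have ji' : (j.-1 <= i + m)%N by lia.
    have := g0 _ (H_edge1 i_n ji'); rewrite -(Xg _ (H_edge1 i_n ji')) flow1 //.
    by case: j ji {ji'}.
  have ji' : (j <= i + m)%N by lia.
  rewrite -subr_ge0 -!derivE //; try lia.
  by have := g0 _ (H_edge0 i_n ji'); rewrite -(Xg _ (H_edge0 i_n ji')) flow0.
- by move=> i i_n; rewrite Xe // big_geq.
- move=> j jn; rewrite -derivE // XD // d_bottom; last by lia.
  by case: j jn.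
- move=> j jn; rewrite -derivE // XD // d_top; last by lia.
  by case: j jn.
Qed.

End Arrays.

(** * Vertices are the points whose flow is supported by a forest *)

Lemma small_step (R : realFieldType) (I : finType) (A : {set I}) (f d : I -> R) :
  (forall i, i \in A -> 0 < f i) ->
  exists2 eps : R, 0 < eps & forall i, i \in A -> eps * `|d i| <= f i.
Proof.
move=> f0; have den i : 0 < 1 + `|d i| by rewrite ltr_pwDl.
exists (\big[Num.min/1]_(i in A) (f i / (1 + `|d i|))).
  by apply: lt_bigmin => // i iA; rewrite divr_gt0 ?f0.
move=> i iA; have := bigmin_le_cond 1 (fun i => f i / (1 + `|d i|)) iA.
set eps := \big[_/_]_(_ in _) _; rewrite ler_pdivlMr // => /(le_trans _); apply.
have : 0 <= eps by apply: ltW; apply: lt_bigmin => // j jA; rewrite divr_gt0 ?f0.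
by move=> eps0; apply: ler_wpM2l => //; rewrite lerDr.
Qed.

Section Subgraphs.
Variables n m : nat.
Implicit Types (H : digraph n m) (u v w : node n m).

Lemma subgraph_edge H u v : is_subgraph H -> (u, v) \in edges H ->
  [/\ (u, v) \in H_edges n m, u \in nodes H & v \in nodes H].
Proof.
by case=> sE sN uvH; case/andP: (sN _ uvH) => uN vN; rewrite (fintype.subsetP sE).
Qed.

Lemma subgraph_row H u v : is_subgraph H -> (u, v) \in edges H ->
  row_of v = (row_of u).+1.
Proof.
by move=> sH /(subgraph_edge sH)[+ _ _]; rewrite H_edgesE => /andP[/eqP].
Qed.

Lemma subgraph_oriented H : is_subgraph H ->
  forall u v, (u, v) \in edges H -> (v, u) \notin edges H.
Proof.
move=> sH u v uvH; apply/negP => vuH.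
by have := subgraph_row sH uvH; rewrite (subgraph_row sH vuH); lia.
Qed.

Lemma uadj_nodes H u v : is_subgraph H -> uadj H u v ->
  (u \in nodes H) && (v \in nodes H).
Proof. by move=> sH /orP[] /(subgraph_edge sH)[_ -> ->]. Qed.

Lemma connect_nodes H u v : is_subgraph H -> u \in nodes H ->
  connect (uadj H) u v -> v \in nodes H.
Proof.
move=> sH uH /connectP[p + ->]; elim: p u uH => //= x p IHp u uH /andP[ux].
by apply: IHp; case/andP: (uadj_nodes sH ux).
Qed.

Lemma connect_isolated H u v : is_subgraph H -> u \notin nodes H ->
  connect (uadj H) u v -> v = u.
Proof.
move=> sH uH /connectP[[|x p] /= + ->] // => /andP[ux].
by case/andP: (uadj_nodes sH ux); rewrite (negPf uH).
Qed.

Lemma delete_edge_subgraph H x : is_subgraph H -> is_subgraph (delete_edge H x).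
Proof.
case=> sE sN; split=> [|y]; first exact: fintype.subset_trans (finset.subD1set _ _) sE.
by rewrite /= in_setD1 => /andP[_]; exact: sN.
Qed.

Lemma componentE H v : is_subgraph H -> v \in nodes H ->
  component H v = [set w | connect (uadj H) v w]%SET.
Proof.
move=> sH vH; apply/setP => w; rewrite !inE andb_idl //.
exact: connect_nodes.
Qed.

Lemma component_delete_edge H u v : is_subgraph H -> (u, v) \in edges H ->
  component (delete_edge H (u, v)) v = branch (uadj H) u v.
Proof.
move=> sH uvH; have [_ _ vH] := subgraph_edge sH uvH.
rewrite componentE //; last exact: delete_edge_subgraph.
apply/setP => w; rewrite !inE; apply: eq_connect.
exact: (und_del_arc (subgraph_oriented sH) uvH).
Qed.

Lemma uadj_sym H : symmetric (uadj H).
Proof. exact: und_sym. Qed.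

Lemma sum_components (V : nmodType) (a : node n m -> V) H :
  is_subgraph H -> (forall Q, Q \in components H -> \sum_(v in Q) a v = 0) ->
  \sum_(v in nodes H) a v = 0.
Proof.
move=> sH a0; rewrite (partition_big (component H) (mem (components H))) /=.
  apply: big1 => Q; case/imsetP => v vH ->.
  rewrite -[RHS](a0 (component H v)) ?imset_f //.
  apply: eq_bigl => w; rewrite [RHS]inE; apply: andb_id2l => wH.
  apply/eqP/idP => [wv|vw].
    have : w \in component H w by rewrite inE wH connect0.
    by rewrite wv inE wH.
  apply/setP => x; rewrite !inE; congr (_ && _).
  by rewrite (same_connect (sym_connect_sym (@uadj_sym H)) vw).
by move=> v vH; apply: imset_f.
Qed.

End Subgraphs.

Section Vertices.
Variables (R : realType) (n m : nat) (lam : (n + m).-tuple R) (lamb : m.-tuple R).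
Hypothesis n0 : (0 < n)%N.
Hypothesis lam_sorted : sorted >=%R lam.
Hypothesis lam_ge0 : forall k : 'I_(n + m), 0 <= tnth lam k.
Implicit Types (X Y Z : array R n m) (u v w : node n m) (H : digraph n m).

Local Notation a := (demand lam lamb).
Local Notation P := (SC lam lamb).

Lemma lam_ext_anti j : lam_ext lam j.+1 <= lam_ext lam j.
Proof.
rewrite /lam_ext /=; case: j => //= j; case: (ltnP j.+1 (n + m)) => jn.
  by move/sortedP: lam_sorted => /(_ 0 j); rewrite size_tuple; apply.
by rewrite (nth_default 0 (n := j.+1)) ?size_tuple // lam_nth_ge0.
Qed.

Lemma support_edges X x :
  (x \in edges (flow_support lam X)) = (x \in H_edges n m) && (0 < flow lam X x).
Proof. by rewrite inE. Qed.

Lemma support_nodesP X v :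
  reflect (exists w, ((v, w) \in edges (flow_support lam X)) ||
                     ((w, v) \in edges (flow_support lam X)))
          (v \in nodes (flow_support lam X)).
Proof.
rewrite finset.in_setU; apply: (iffP orP) => [[] /imsetP[[x y] xE ->]|[w /orP[] vE]].
- by exists y; rewrite xE.
- by exists x; rewrite xE orbT.
- by left; apply/imsetP; exists (v, w).
- by right; apply/imsetP; exists (w, v).
Qed.

Lemma support_subgraph X : is_subgraph (flow_support lam X).
Proof.
split; first by apply/fintype.subsetP => x; rewrite support_edges => /andP[].
by move=> [u v] uvE /=; apply/andP; split; apply/support_nodesP;
  [exists v|exists u]; rewrite uvE ?orbT.
Qed.

Lemma flow_notin X x : P X -> x \in H_edges n m ->
  x \notin edges (flow_support lam X) -> flow lam X x = 0.
Proof.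
move=> XP xH; rewrite support_edges xH /= -leNgt => le0.
by apply/eqP; rewrite eq_le le0 (SC_flow_ge0 n0 lam_ge0 XP).
Qed.

Lemma forest_flow_excess X H u v : P X -> is_forest H ->
  (forall x, x \in H_edges n m -> x \notin edges H -> flow lam X x = 0) ->
  (u, v) \in edges H ->
  flow lam X (u, v) = excess lam lamb (component (delete_edge H (u, v)) v).
Proof.
move=> XP [sH acH] X0 uvH; rewrite component_delete_edge // excessE.
rewrite (forest_flow (subgraph_oriented sH) acH) //; apply: eq_bigr => w _.
by rewrite -(netflow_sub sH.1 X0) (SC_netflow n0 XP).
Qed.

Lemma forest_flow_determined X Y H : P X -> P Y -> is_forest H ->
  (forall x, x \in H_edges n m -> x \notin edges H -> flow lam X x = 0) ->
  (forall x, x \in H_edges n m -> x \notin edges H -> flow lam Y x = 0) ->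
  X = Y.
Proof.
move=> XP YP fH X0 Y0; have [_ Xl _ Xt] := XP; have [_ Yl _ Yt] := YP.
apply: (flow_inj (lam := lam)).
- by move=> i i_n; rewrite Xl ?Yl.
- by move=> j jm; rewrite Xt ?Yt.
move=> x xE; have [xH|xH] := boolP (x \in edges H); last by rewrite X0 ?Y0.
by case: x xE xH => u v _ uvH; rewrite !(forest_flow_excess _ fH).
Qed.

(** In a proper convex combination of nonnegative flows both have their support
    inside that of the combination, so the forest determines them. *)
Lemma forest_vertex X : P X -> is_forest (flow_support lam X) -> vertices P X.
Proof.
move=> XP fX; split=> // Y Z t YP ZP /andP[t0 t1] XE.
have YZ0 x : x \in H_edges n m -> x \notin edges (flow_support lam X) ->
    flow lam Y x = 0 /\ flow lam Z x = 0.
  move=> xE xX; have := flow_notin XP xE xX; rewrite XE flow_affine => /eqP.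
  have Y0 := SC_flow_ge0 n0 lam_ge0 YP xE.
  have Z0 := SC_flow_ge0 n0 lam_ge0 ZP xE.
  have t1' : 0 < 1 - t by rewrite subr_gt0.
  rewrite (paddr_eq0 (mulr_ge0 (ltW t0) Y0) (mulr_ge0 (ltW t1') Z0)).
  rewrite !mulf_eq0 (gt_eqF t0) (gt_eqF t1') /=.
  by move=> /andP[/eqP-> /eqP->].
by apply: (forest_flow_determined YP ZP fX) => x xE xX; case: (YZ0 x xE xX).
Qed.

Lemma vertex_forest X : vertices P X -> is_forest (flow_support lam X).
Proof.
case=> XP Xext; split; first exact: support_subgraph.
move=> c c3 cyc; set E := edges (flow_support lam X).
have sE : E \subset H_edges n m := (support_subgraph X).1.
have [d [d0 [x xE dx]]] :=
  cycle_circulation R (subgraph_oriented (support_subgraph X)) c3 cyc.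
have fpos y : y \in E -> 0 < flow lam X y.
  by rewrite support_edges => /andP[].
have [eps eps0 epsE] := small_step d fpos.
(* Flows of the two perturbed points, for [s = eps] and [s = - eps]. *)
pose g (s : R) y := flow lam X y + (if y \in E then s * d y else 0).
have arr s : `|s| = eps ->
    exists2 Y, P Y & {in H_edges n m, flow lam Y =1 g s}.
  move=> sE'; apply: array_of_flow => // [y yH|w].
    rewrite /g; case: ifP => yE; last by rewrite addr0 (SC_flow_ge0 n0 lam_ge0 XP).
    have := epsE y yE; rewrite -sE' -normrM => le_f.
    by rewrite -[s * _]opprK subr_ge0 (le_trans _ le_f) // -normrN ler_norm.
  pose d' y := if y \in E then s * d y else 0.
  rewrite netflowD (SC_netflow n0 XP) (netflow_sub sE); last first.
    by move=> y _; rewrite /d' => /negPf ->.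
  rewrite (@eq_netflow _ _ _ _ (fun y => s * d y)); last first.
    by move=> y yE; rewrite /d' yE.
  by rewrite netflowZ d0 mulr0 addr0.
have [Y YP Yg] := arr eps (gtr0_norm eps0).
have [Z ZP Zg] : exists2 Y, P Y & {in H_edges n m, flow lam Y =1 g (- eps)}.
  by apply: arr; rewrite normrN gtr0_norm.
have [_ Xl _ Xt] := XP; have [_ Yl _ Yt] := YP; have [_ Zl _ Zt] := ZP.
have YZ : Y = Z.
  apply: (Xext _ _ (2^-1)) => //; first by apply/andP; split; lra.
  apply: (flow_inj (lam := lam)).
  - by move=> i i_n; rewrite entry_affine Xl ?Yl ?Zl // !mulr0 addr0.
  - by move=> j jm; rewrite row_deriv_affine Xt ?Yt ?Zt //; field.
  move=> y yH; rewrite flow_affine Yg // Zg // /g; case: ifP => _; by field.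
have xH := fintype.subsetP sE x xE.
have := Yg x xH; rewrite YZ Zg // /g xE => /addrI.
by case/orP: dx => /eqP ->; lra.
Qed.

End Vertices.

(** * Supports of vertices and admissible forests *)

Lemma psumr_gt0 (R : realDomainType) (I : finType) (A : pred I) (f : I -> R) :
  (forall i, A i -> 0 <= f i) ->
  (0 < \sum_(i | A i) f i) = [exists i, A i && (0 < f i)].
Proof.
move=> f0; rewrite lt0r sumr_ge0 // andbT psumr_eq0 // -has_predC.
apply/hasP/existsP => [[i _ /=]|[i /andP[Ai fi]]].
  by rewrite negb_imply => /andP[Ai fi]; exists i; rewrite Ai lt0r fi f0.
by exists i; rewrite ?mem_index_enum //= negb_imply Ai gt_eqF.
Qed.

Lemma digraph_eq n m (H H' : digraph n m) :
  nodes H = nodes H' -> edges H = edges H' -> H = H'.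
Proof. by case: H => N E; case: H' => N' E' /= -> ->. Qed.

Section Admissible.
Variables (R : realType) (n m : nat) (lam : (n + m).-tuple R) (lamb : m.-tuple R).
Hypothesis n0 : (0 < n)%N.
Hypothesis lam_sorted : sorted >=%R lam.
Hypothesis lam_ge0 : forall k : 'I_(n + m), 0 <= tnth lam k.
Implicit Types (X Y Z : array R n m) (u v w : node n m) (H : digraph n m).

Local Notation a := (demand lam lamb).
Local Notation P := (SC lam lamb).

Lemma demand_bottom v : row_of v = n ->
  a v = lam_ext lam (col_of v) - lam_ext lam (col_of v).+1.
Proof. by rewrite /demand => ->; rewrite eqxx (gtn_eqF n0) subr0. Qed.

Lemma demand_top v : row_of v = 0%N ->
  a v = - (lamb_ext lam lamb (col_of v) - lamb_ext lam lamb (col_of v).+1).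
Proof. by rewrite /demand => ->; rewrite (ltn_eqF n0) eqxx sub0r. Qed.

Lemma demand_inner v : row_of v != n -> row_of v != 0%N -> a v = 0.
Proof. by rewrite /demand => /negPf -> /negPf ->; rewrite subrr. Qed.

Lemma demand_bottom_ge0 v : row_of v = n -> 0 <= a v.
Proof. by move=> r; rewrite demand_bottom // subr_ge0 lam_ext_anti. Qed.

Lemma lam_nodesE v : (v \in lam_nodes lam) = (row_of v == n) && (0 < a v).
Proof.
rewrite inE; apply: andb_id2l => /eqP r; rewrite demand_bottom // subr_gt0.
by rewrite andb_idl //; case: (col_of v) => //; rewrite ltxx.
Qed.

Lemma lamb_nodesE v : (v \in lamb_nodes lam lamb) = (row_of v == 0%N) && (a v < 0).
Proof.
rewrite inE; apply: andb_id2l => /eqP r.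
by rewrite demand_top // oppr_lt0 subr_gt0.
Qed.

Lemma sum_demand_bottom : \sum_(v | row_of v == n) a v = lam`_0.
Proof.
rewrite (eq_bigr _ (fun v r => demand_bottom (eqP r))).
rewrite (sum_row m (fun j => lam_ext lam j - lam_ext lam j.+1)) //.
rewrite (sum_tail (G := lam_ext lam)) //.
by rewrite /lam_ext /= nth_default // size_tuple.
Qed.

Lemma sum_demand_top : \sum_(v | row_of v == 0%N) a v = - lam`_0.
Proof.
rewrite (eq_bigr _ (fun v r => demand_top (eqP r))) sumrN.
rewrite (sum_row m (fun j => lamb_ext lam lamb j - lamb_ext lam lamb j.+1)) //.
rewrite (sum_tail (G := lamb_ext lam lamb)) //.
by rewrite /lamb_ext /= nth_default // size_tuple.
Qed.

(** Both boundary rows telescope, from lambda_1 down to 0. *)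
Lemma sum_demand : \sum_(w : node n m) a w = 0.
Proof.
rewrite (bigID (fun w => row_of w == n)) /= sum_demand_bottom.
rewrite (bigID (fun w => row_of w == 0%N)) /= [X in _ + (_ + X)]big1.
  rewrite (eq_bigl (fun w => row_of w == 0%N)) ?sum_demand_top ?addr0 ?subrr //.
  by move=> w; case: eqP => //= ->; rewrite (gtn_eqF n0).
by move=> w /andP[? ?]; exact: demand_inner.
Qed.

Lemma support_out X v : P X ->
  (0 < \sum_(w | (v, w) \in H_edges n m) flow lam X (v, w)) =
  [exists w, (v, w) \in edges (flow_support lam X)].
Proof.
move=> XP; rewrite psumr_gt0; last by move=> w; exact: SC_flow_ge0 XP _.
by apply: eq_existsb => w; rewrite support_edges.
Qed.

Lemma support_in X v : P X ->
  (0 < \sum_(u | (u, v) \in H_edges n m) flow lam X (u, v)) =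
  [exists u, (u, v) \in edges (flow_support lam X)].
Proof.
move=> XP; rewrite psumr_gt0; last by move=> u; exact: SC_flow_ge0 XP _.
by apply: eq_existsb => u; rewrite support_edges.
Qed.

Lemma support_balance X v : P X ->
  \sum_(u | (u, v) \in H_edges n m) flow lam X (u, v) =
  \sum_(w | (v, w) \in H_edges n m) flow lam X (v, w) + a v.
Proof.
by move=> XP; rewrite -(SC_netflow n0 XP) netflow_arcs addrC subrK.
Qed.

Lemma support_in_ge0 X v : P X ->
  0 <= \sum_(u | (u, v) \in H_edges n m) flow lam X (u, v).
Proof. by move=> XP; apply: sumr_ge0 => u; exact: SC_flow_ge0 XP _. Qed.

Lemma support_out_ge0 X v : P X ->
  0 <= \sum_(w | (v, w) \in H_edges n m) flow lam X (v, w).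
Proof. by move=> XP; apply: sumr_ge0 => u; exact: SC_flow_ge0 XP _. Qed.

Lemma H_no_in v : row_of v = 0%N -> forall u, (u, v) \notin H_edges n m.
Proof. by move=> r u; rewrite H_edgesE r. Qed.

Lemma H_no_out v : row_of v = n -> forall w, (v, w) \notin H_edges n m.
Proof.
by move=> r w; rewrite H_edgesE r; have := row_le w; case: eqP => //; lia.
Qed.

Lemma support_roots X : P X ->
  Defs.roots (flow_support lam X) = lamb_nodes lam lamb.
Proof.
move=> XP; apply/setP => v; rewrite lamb_nodesE inE.
apply/andP/andP => [[/support_nodesP[w vw] /forallP noin]|[/eqP r av]].
  have [|nin] := ltP 0 (\sum_(u | (u, v) \in H_edges n m) flow lam X (u, v)).
    by rewrite support_in // => /existsP[u]; rewrite (negPf (noin u)).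
  have out : 0 < \sum_(w | (v, w) \in H_edges n m) flow lam X (v, w).
    rewrite support_out //; apply/existsP; exists w.
    by case/orP: vw => // wv; rewrite (negPf (noin w)) in wv.
  have av : a v < 0 by have := support_balance v XP; lra.
  split=> //; apply: contraTT av => r0; rewrite -leNgt.
  by have [/demand_bottom_ge0//|rn] := eqVneq (row_of v) n; rewrite demand_inner.
split; last first.
  apply/forallP => u; apply: contra (H_no_in r u).
  by rewrite support_edges => /andP[].
have : 0 < \sum_(w | (v, w) \in H_edges n m) flow lam X (v, w).
  by have := support_balance v XP; have := support_in_ge0 v XP; lra.
rewrite support_out // => /existsP[w vw].
by apply/support_nodesP; exists w; rewrite vw.
Qed.

Lemma support_leaves X : P X -> leaves (flow_support lam X) = lam_nodes lam.
Proof.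
move=> XP; apply/setP => v; rewrite lam_nodesE inE.
apply/andP/andP => [[/support_nodesP[w vw] /forallP noout]|[/eqP r av]].
  have [|nout] := ltP 0 (\sum_(w | (v, w) \in H_edges n m) flow lam X (v, w)).
    by rewrite support_out // => /existsP[u]; rewrite (negPf (noout u)).
  have wvE : (w, v) \in edges (flow_support lam X).
    by case/orP: vw => // wv; rewrite (negPf (noout w)) in wv.
  have hin : 0 < \sum_(u | (u, v) \in H_edges n m) flow lam X (u, v).
    by rewrite support_in //; apply/existsP; exists w.
  have av : 0 < a v by have := support_balance v XP; lra.
  split=> //; apply: contraTT av => rn; rewrite demand_inner ?ltxx //.
  by rewrite (subgraph_row (support_subgraph lam X) wvE).
split; last first.
  apply/forallP => u; apply: contra (H_no_out r u).
  by rewrite support_edges => /andP[].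
have : 0 < \sum_(u | (u, v) \in H_edges n m) flow lam X (u, v).
  by have := support_balance v XP; have := support_out_ge0 v XP; lra.
rewrite support_in // => /existsP[w vw].
by apply/support_nodesP; exists w; rewrite vw orbT.
Qed.

Lemma vertex_admissible X : vertices P X ->
  admissible_forests lam lamb (flow_support lam X).
Proof.
move=> vX; have fX := vertex_forest n0 lam_ge0 vX; have XP := vX.1.
have sX := support_subgraph lam X; split=> //.
- exact: support_roots.
- exact: support_leaves.
- move=> Q /imsetP[v vH ->]; rewrite componentE // excessE.
  rewrite -[RHS](sum_netflow_component (edges (flow_support lam X)) (flow lam X) v).
  apply: eq_big => w; first by rewrite inE.
  move=> _; rewrite -(netflow_sub sX.1) ?(SC_netflow n0 XP) // => x.
  exact: flow_notin XP.
- move=> u v uvE; rewrite -(forest_flow_excess n0 XP fX) //.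
    by move: uvE; rewrite support_edges => /andP[].
  by move=> x; exact: flow_notin XP.
Qed.

(** An isolated node would be at once a root, in row 0, and a leaf, in row
    [n]. *)
Lemma admissible_touched H v : admissible_forests lam lamb H ->
  v \in nodes H -> exists w, ((v, w) \in edges H) || ((w, v) \in edges H).
Proof.
move=> [_ Hr Hl _ _] vH.
have [/existsP//|] := boolP [exists w, ((v, w) \in edges H) || ((w, v) \in edges H)].
rewrite negb_exists => /forallP no.
have : v \in lamb_nodes lam lamb.
  rewrite -Hr inE vH; apply/forallP => u.
  by have := no u; rewrite negb_or => /andP[].
have : v \in lam_nodes lam.
  rewrite -Hl inE vH; apply/forallP => u.
  by have := no u; rewrite negb_or => /andP[].
rewrite lam_nodesE lamb_nodesE => /andP[/eqP r _] /andP[/eqP r0 _].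
by move: (gtn_eqF n0); rewrite -[in LHS]r r0.
Qed.

(** The conditions on roots and leaves make the demand nonnegative outside the
    forest; as the demands add up to 0 over the forest and over all nodes, it
    vanishes there.  This is where a lambdabar whose first entry exceeds
    lambda_1, or whose last entry is negative, is excluded. *)
Lemma admissible_demand_out H v : admissible_forests lam lamb H ->
  v \notin nodes H -> a v = 0.
Proof.
move=> [[sH _] Hr Hl Hc _].
have bottom0 w : row_of w = n -> w \notin nodes H -> a w = 0.
  move=> r wH; apply/eqP; rewrite eq_le demand_bottom_ge0 // andbT leNgt.
  apply: contra wH => aw; have : w \in lam_nodes lam by rewrite lam_nodesE r eqxx.
  by rewrite -Hl inE => /andP[].
have top_ge0 w : row_of w = 0%N -> w \notin nodes H -> 0 <= a w.
  move=> r wH; rewrite leNgt; apply: contra wH => aw.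
  have : w \in lamb_nodes lam lamb by rewrite lamb_nodesE r eqxx.
  by rewrite -Hr inE => /andP[].
have total : \sum_(w in nodes H) a w = 0.
  by apply: sum_components => // Q /Hc; rewrite excessE.
have out_ge0 w : w \notin nodes H -> 0 <= a w.
  move=> wH; have [/top_ge0->//|r0] := eqVneq (row_of w) 0%N.
  by have [/bottom0->//|rn] := eqVneq (row_of w) n; rewrite demand_inner.
have := sum_demand; rewrite (bigID (mem (nodes H))) /= total add0r => /eqP.
by rewrite psumr_eq0 // => /allP/(_ v (mem_index_enum v))/implyP + vH => /(_ vH)/eqP.
Qed.

Lemma admissible_support H : admissible_forests lam lamb H ->
  exists2 X, vertices P X & flow_support lam X = H.
Proof.
move=> aH; have [fH _ _ Hc He] := aH; have [sH acH] := fH.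
have orH := subgraph_oriented sH.
have a0 v : \sum_(w | connect (uadj H) v w) a w = 0.
  have [vH|vH] := boolP (v \in nodes H).
    rewrite -[RHS](Hc (component H v)) ?imset_f // excessE componentE //.
    by apply: eq_bigl => w; rewrite inE.
  rewrite (big_pred1 v) ?(admissible_demand_out aH) // => w.
  by apply/idP/eqP => [/(connect_isolated sH vH)->|->].
pose g x := if x \in edges H then \sum_(w in branch (uadj H) x.1 x.2) a w else 0.
have g_pos x : x \in edges H -> 0 < g x.
  case: x => u v uvE; rewrite /g uvE -component_delete_edge // -excessE.
  exact: He.
have g_out x : x \notin edges H -> g x = 0 by rewrite /g => /negPf ->.
have [|w|X XP Xg] := array_of_flow (lam := lam) (lamb := lamb) (g := g) n0.
- move=> x _; have [/g_pos/ltW//|/g_out->//] := boolP (x \in edges H).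
- rewrite (netflow_sub sH.1) => [|x _ /g_out//].
  rewrite -[RHS](forest_flow_exists orH acH a0); apply: eq_netflow => x xE.
  by rewrite /g xE.
have XE : edges (flow_support lam X) = edges H.
  apply/setP => x; rewrite support_edges.
  have [xH|xH] := boolP (x \in edges H).
    have xE : x \in H_edges n m := fintype.subsetP sH.1 x xH.
    by rewrite xE Xg // g_pos.
  by apply/negP => /andP[xE]; rewrite Xg // g_out // ltxx.
have XH : flow_support lam X = H.
  apply: digraph_eq => //; apply/setP => v.
  apply/support_nodesP/idP => [[w]|/(admissible_touched aH)[w vw]].
    by rewrite XE => /orP[] /(subgraph_edge sH)[].
  by exists w; rewrite XE.
exists X => //; apply: forest_vertex => //.
by rewrite XH.
Qed.

End Admissible.

(** * Rooted trees and the correspondence *)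

Section Trees.
Variables n m : nat.
Implicit Types (H : digraph n m) (E : {set node n m * node n m}) (u v w : node n m).

(** Following arcs downwards raises the row at each step, so that only arcs at or
    below row [k] are used; with this bound the path can be kept away from a
    deleted arc. *)
Lemma reach_leaf H E k v : is_subgraph H ->
  (forall x, x \in edges H -> (k <= row_of x.1)%N -> x \in E) ->
  v \in nodes H -> (k <= row_of v)%N ->
  exists2 l, l \in leaves H & connect (und E) v l.
Proof.
move=> sH EH; move eqd : (n - row_of v)%N => d.
elim: d v eqd => [|d IHd] v eqd vH kv; have [vl|] := boolP (v \in leaves H);
  try by exists v.
  all: rewrite inE vH negb_forall => /existsP[w /negPn vw].
  by have := subgraph_row sH vw; have := row_le w; lia.
have [vwE _ wH] := subgraph_edge sH vw; have rw := subgraph_row sH vw.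
have [||l lH wl] := IHd w _ wH; try lia.
exists l => //; apply: connect_trans (connect1 _) wl.
by rewrite /und (EH (v, w)).
Qed.

Lemma reach_root H E k v : is_subgraph H ->
  (forall x, x \in edges H -> (row_of x.2 <= k)%N -> x \in E) ->
  v \in nodes H -> (row_of v <= k)%N ->
  exists2 r, r \in Defs.roots H & connect (und E) v r.
Proof.
move=> sH EH; move eqd : (row_of v) => d.
elim: d v eqd => [|d IHd] v eqd vH kv; have [vl|] := boolP (v \in Defs.roots H);
  try by exists v.
  all: rewrite inE vH negb_forall => /existsP[u /negPn uv].
  by have := subgraph_row sH uv; lia.
have [uvE uH _] := subgraph_edge sH uv; have rv := subgraph_row sH uv.
have [||r rH ur] := IHd u _ uH; try lia.
exists r => //; apply: connect_trans (connect1 _) ur.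
by rewrite /und (EH (u, v)) ?orbT //= eqd.
Qed.

End Trees.

Section EmptyLambdabar.
Variables (R : realType) (n m : nat) (lam : (n + m).-tuple R) (lamb : m.-tuple R).
Hypothesis n0 : (0 < n)%N.
Hypothesis lam_sorted : sorted >=%R lam.
Hypothesis lam_ge0 : forall k : 'I_(n + m), 0 <= tnth lam k.
Hypothesis m0 : m = 0%N.
Hypothesis lam_gt0 : 0 < lam`_0.
Implicit Types (H : digraph n m) (u v w : node n m).

Local Notation a := (demand lam lamb).

Lemma top_origin v : row_of v = 0%N -> v = origin n m.
Proof.
move=> r; apply: node_eq => //; have := col_le v.
have -> : col_of (origin n m) = 0%N by [].
lia.
Qed.

Lemma lamb_nodes_origin : lamb_nodes lam lamb = [set origin n m]%SET.
Proof.
apply/setP => v; rewrite !inE; apply/andP/eqP => [[/eqP/top_origin//]|->].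
by rewrite /lamb_ext /= nth_default // size_tuple m0.
Qed.

Lemma admissible_tree H : admissible_forests lam lamb H ->
  is_rooted_tree H /\ leaves H = lam_nodes lam.
Proof.
move=> [fH Hr Hl _ _]; have [sH _] := fH.
split=> //; split; rewrite -?lamb_nodes_origin //.
have to_origin v : v \in nodes H -> connect (uadj H) v (origin n m).
  move=> vH; have [//|r] := @reach_root _ _ H (edges H) n v sH _ vH (row_le v).
  by rewrite Hr lamb_nodes_origin inE => /eqP ->.
move=> u v /to_origin uo /to_origin vo; apply: connect_trans uo _.
by rewrite (sym_connect_sym (@uadj_sym _ _ H)).
Qed.

(** The part cut off by deleting [(u, v)] contains a leaf below [v] but not the
    origin, which stays joined to [u]; apart from the origin no node has negative
    demand. *)
Lemma tree_admissible H : is_rooted_tree H -> leaves H = lam_nodes lam ->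
  admissible_forests lam lamb H.
Proof.
move=> [fH conH Hr] Hl; have [sH acH] := fH.
have oH : origin n m \in nodes H.
  have : origin n m \in Defs.roots H by rewrite Hr inE.
  by rewrite inE => /andP[].
split=> //; first by rewrite lamb_nodes_origin.
  move=> Q /imsetP[v vH ->]; rewrite excessE.
  rewrite -[RHS](sum_demand lam lamb n0) [RHS](bigID (mem (nodes H))) /=.
  rewrite [X in _ = _ + X]big1 => [|w wH].
    rewrite addr0; apply: eq_bigl => w; rewrite inE andb_idr // => wH.
    exact: conH.
  have [r|r0] := eqVneq (row_of w) 0%N; first by rewrite (top_origin r) oH in wH.
  have [r|rn] := eqVneq (row_of w) n; last exact: demand_inner.
  apply/eqP; rewrite eq_le demand_bottom_ge0 // andbT leNgt.
  apply: contra wH => aw; have : w \in lam_nodes lam.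
    by rewrite (lam_nodesE _ lamb) // r eqxx.
  by rewrite -Hl inE => /andP[].
move=> u v uvH; have [uvE uH vH] := subgraph_edge sH uvH.
have ruv := subgraph_row sH uvH.
have sH' : is_subgraph (delete_edge H (u, v)) by exact: delete_edge_subgraph.
set Q := component _ v.
have QE : Q = [set w | connect (uadj (delete_edge H (u, v))) v w]%SET.
  exact: componentE.
have oQ : origin n m \notin Q.
  apply/negP; rewrite QE inE => vo.
  have uQ : u \notin Q.
    rewrite /Q component_delete_edge //; apply: bridge => //.
      exact: und_irr (subgraph_oriented sH).
    by rewrite /uadj uvH.
  case/negP: uQ; rewrite QE inE; apply: connect_trans vo _.
  rewrite (sym_connect_sym (@uadj_sym _ _ _)).
  have [|r] := @reach_root _ _ H (edges H :\ (u, v))%SET (row_of u) u sH _ uH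
    (leqnn _).
    move=> x xH xu; rewrite in_setD1 xH andbT; apply: contraTneq xu => ->.
    by rewrite /= ruv ltnn.
  by rewrite Hr inE => /eqP ->.
have [|l lH vl] := @reach_leaf _ _ H (edges H :\ (u, v))%SET (row_of v) v sH _ vH
    (leqnn _).
  move=> x xH xu; rewrite in_setD1 xH andbT; apply: contraTneq xu => ->.
  by rewrite /= ruv ltnn.
have lQ : l \in Q by rewrite QE inE.
rewrite excessE psumr_gt0.
  apply/existsP; exists l; rewrite lQ /=.
  by move: lH; rewrite Hl (lam_nodesE _ lamb) // => /andP[].
move=> w wQ; have [r|r0] := eqVneq (row_of w) 0%N.
  by rewrite (top_origin r) (negPf oQ) in wQ.
have [r|rn] := eqVneq (row_of w) n; first exact: demand_bottom_ge0.
by rewrite demand_inner.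
Qed.

End EmptyLambdabar.

Theorem corollary2 (R : realType) (n m : nat) (lam : (n + m).-tuple R)
    (lamb : m.-tuple R) (hn : (1 <= n)%N)
    (hlam : sorted >=%R lam) (hlamb : sorted >=%R lamb)
    (hlam0 : forall k : 'I_(n + m), 0 <= tnth lam k) :
  set_bij (vertices (SC lam lamb)) (admissible_forests lam lamb)
    (flow_support lam)
  /\
  (m = 0%N -> 0 < lam`_0 ->
   set_bij (vertices (SC lam lamb))
     (fun H : digraph n m => is_rooted_tree H /\ leaves H = lam_nodes lam)
     (flow_support lam)).
Proof.
have bij : set_bij (vertices (SC lam lamb)) (admissible_forests lam lamb)
    (flow_support lam).
  split.
  - by move=> X; apply: vertex_admissible.
  - move=> X Y /set_mem vX /set_mem vY eqH.
    have fX := vertex_forest hn hlam0 vX.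
    apply: (forest_flow_determined hn vX.1 vY.1 fX) => x.
      exact: flow_notin vX.1.
    by rewrite eqH; exact: flow_notin vY.1.
  - by move=> H /(admissible_support hn hlam hlam0)[X vX XH]; exists X.
split=> // m0 lam_gt0.
rewrite (_ : (fun H => _) = admissible_forests lam lamb) //.
apply/seteqP; split=> H; last exact: admissible_tree.
by case; exact: tree_admissible.
Qed.
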